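(* Let $\mathcal{M}^{II}_m$ be a timelike second kind meridian surface of hyperbolic type in $\mathbb{R}^4_1$, parametrized by $z(u,v)=f(u)\,l(v)+g(u)\,e_1$, $u\in I$, $v\in J$. Then $\mathcal{M}^{II}_m$ is minimal if and only if the curve $l=l(v)$ on $\mathbb{H}^2(-1)$ has zero curvature and the meridian curve $m:u\mapsto(f(u),g(u))$ is given by $$f(u)=\pm\sqrt{u^2+2au+b},\qquad g(u)=\pm\sqrt{a^2-b}\,\ln\left|u+a+\sqrt{u^2+2au+b}\right|+c,$$ where $a,b,c$ are constants with $a^2-b>0$.
   Context: $\mathbb{R}^4_1$ is the Minkowski 4-space with metric $\langle\cdot,\cdot\rangle = dx_1^2+dx_2^2+dx_3^2-dx_4^2$ and standard orthonormal frame $e_1,e_2,e_3,e_4$ ($e_4$ timelike). $\mathbb{H}^2(-1)=\{V\in\mathrm{span}\{e_2,e_3,e_4\}:\langle V,V\rangle=-1,\ \text{the } e_4\text{-coordinate of }V\text{ is positive}\}$. A timelike second kind meridian surface of hyperbolic type is the surface $z(u,v)=f(u)l(v)+g(u)e_1$, where $I,J\subset\mathbb{R}$ are intervals, $f,g:I\to\mathbb{R}$ are smooth with $f>0$, and $l:J\to\mathbb{H}^2(-1)$ is a smooth curve with $\langle l',l'\rangle=1$ (prime $=d/dv$). The meridian curve is normalized by $\dot f^2-\dot g^2=1$ (dot $=d/du$), so the induced metric $-du^2+f(u)^2dv^2$ is Lorentzian, and $\dot g\neq0$ on $I$, i.e. $\dot f^2>1$. The curvature of $l$ is $\varkappa(v)=\langle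 t'(v),n(v)\rangle$, where $t=l'$ and $\{l,t,n\}$ is an orthonormal frame field of $\mathrm{span}\{e_2,e_3,e_4\}$ with $\langle n,n\rangle=1$ (so $t'=\varkappa n+l$, $n'=-\varkappa t$). The mean curvature vector field is $H=\frac12(\sigma(x,x)-\sigma(y,y))$, with $\sigma$ the second fundamental form and $\{x,y\}$ an orthonormal tangent frame with $\langle x,x\rangle=1$, $\langle y,y\rangle=-1$. The surface is minimal if $H=0$ identically. *)

(* Defs.v *)
From HB Require Import structures.
From mathcomp Require Import all_boot all_order all_algebra.
From mathcomp Require Import all_classical all_reals all_analysis.
From mathcomp Require Import ring.

Set Implicit Arguments.
Unset Strict Implicit.
Unset Printing Implicit Defensive.

Import Order.TTheory GRing.Theory Num.Theory.
Import numFieldNormedType.Exports.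

Local Open Scope classical_set_scope.
Local Open Scope ring_scope.

Section Minkowski.
Variable R : realType.
Local Notation V := 'rV[R]_4.

(* The coordinates x_1, ..., x_4 are indexed by 0, ..., 3. *)
Definition mink (X Y : V) : R :=
  X 0 0 * Y 0 0 + X 0 1 * Y 0 1 + X 0 2%:R * Y 0 2%:R - X 0 3%:R * Y 0 3%:R.

Definition e1 : V := delta_mx 0 0.
Definition e2 : V := delta_mx 0 1.
Definition e3 : V := delta_mx 0 2%:R.
Definition e4 : V := delta_mx 0 3%:R.

Definition span234 : set V :=
  [set X | exists p q r : R, X = p *: e2 + q *: e3 + r *: e4].

Definition H2 : set V :=
  [set X | [/\ span234 X, mink X X = -1 & 0 < X 0 3%:R]].

(* Arbitrary intervals (open or not, bounded or not), not reduced to a point. *)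
Definition nondegenerate_interval (I : set R) : Prop :=
  is_interval I /\ exists p q, [/\ I p, I q & p < q].

(* A map defined on I is represented by a total function of which only the
   values on I matter. Smoothness on an interval which may contain its
   endpoints has the usual meaning: existence of a smooth extension to an open
   neighbourhood of I, the total function being that extension near I. At an
   endpoint of I the derivatives are then the one-sided ones, which depend only
   on the values on I; if I is open one can take U = I. *)
Definition smooth_on (W : normedModType R) (I : set R) (h : R -> W) : Prop :=
  exists U : set R, [/\ open U, I `<=` U &
    forall (k : nat) (x : R), U x -> derivable (derive1n k h) x 1].

Section ParametrizedSurface.
Variable z : R -> R -> V.

Definition z_u (u v : R) : V := derive1 (z ^~ v) u.
Definition z_v (u v : R) : V := derive1 (z u) v.
Definition z_uu (u v : R) : V := derive1 (z_u ^~ v) u.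
Definition z_uv (u v : R) : V := derive1 (z_u u) v.
Definition z_vv (u v : R) : V := derive1 (z_v u) v.

(* A tangent vector at z(u,v) is given by its components in (z_u, z_v). *)
Definition tangent (u v : R) (x : R * R) : V :=
  x.1 *: z_u u v + x.2 *: z_v u v.

Definition coefE u v : R := mink (z_u u v) (z_u u v).
Definition coefF u v : R := mink (z_u u v) (z_v u v).
Definition coefG u v : R := mink (z_v u v) (z_v u v).

(* Component of X orthogonal to the tangent plane, the tangential component
   being computed with the inverse of the Gram matrix of (z_u, z_v); see
   [normal_part_u], [normal_part_v] and [normal_part_tangent]. *)
Definition tangent_coord u v (X : V) : R * R :=
  let d := coefE u v * coefG u v - coefF u v ^+ 2 in
  let p := mink X (z_u u v) in
  let q := mink X (z_v u v) in
  ((coefG u v * p - coefF u v * q) / d, (coefE u v * q - coefF u v * p) / d).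

Definition normal_part u v (X : V) : V :=
  X - tangent u v (tangent_coord u v X).

(* sigma(x, y) is the normal part of the ambient derivative along x of a tangent
   field extending y; with constant components this derivative is the
   combination of second partial derivatives below. *)
Definition sff u v (x y : R * R) : V :=
  normal_part u v ((x.1 * y.1) *: z_uu u v
                   + (x.1 * y.2 + x.2 * y.1) *: z_uv u v
                   + (x.2 * y.2) *: z_vv u v).

Definition orthonormal_tangent_frame u v (x y : R * R) : Prop :=
  [/\ mink (tangent u v x) (tangent u v x) = 1,
      mink (tangent u v y) (tangent u v y) = -1 &
      mink (tangent u v x) (tangent u v y) = 0].

Definition mean_curvature_vector u v (x y : R * R) : V :=
  2^-1 *: (sff u v x x - sff u v y y).

(* The mean curvature vector at a point does not depend on the frame. *)
Definition minimal (I J : set R) : Prop :=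
  forall u v, I u -> J v -> forall x y, orthonormal_tangent_frame u v x y ->
    mean_curvature_vector u v x y = 0.

End ParametrizedSurface.

Definition meridian_surface (f g : R -> R) (l : R -> V) (u v : R) : V :=
  f u *: l v + g u *: e1.

Definition unit_speed_curve_in_H2 (J : set R) (l : R -> V) : Prop :=
  [/\ smooth_on J l, forall v, J v -> H2 (l v) &
      forall v, J v -> mink (derive1 l v) (derive1 l v) = 1].

(* {l, l', n} is an orthonormal frame field of span{e2, e3, e4} along l. *)
Definition normal_field (J : set R) (l n : R -> V) : Prop :=
  smooth_on J n /\
  forall v, J v -> [/\ span234 (n v), mink (n v) (n v) = 1,
                       mink (n v) (l v) = 0 & mink (n v) (derive1 l v) = 0].

Definition curvature (l n : R -> V) (v : R) : R := mink (derive1n 2 l v) (n v).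

Definition meridian_curve (I : set R) (f g : R -> R) : Prop :=
  [/\ smooth_on I f, smooth_on I g, forall u, I u -> 0 < f u,
      forall u, I u -> (derive1 f u) ^+ 2 - (derive1 g u) ^+ 2 = 1 &
      forall u, I u -> derive1 g u != 0].

Definition timelike_meridian_surface_II_hyperbolic
    (I J : set R) (f g : R -> R) (l : R -> V) : Prop :=
  [/\ nondegenerate_interval I, nondegenerate_interval J,
      meridian_curve I f g & unit_speed_curve_in_H2 J l].

Lemma minkC X Y : mink X Y = mink Y X.
Proof. by rewrite /mink; ring. Qed.

Lemma minkDl X Y Z : mink (X + Y) Z = mink X Z + mink Y Z.
Proof. by rewrite /mink !mxE; ring. Qed.

Lemma minkZl (p : R) X Y : mink (p *: X) Y = p * mink X Y.
Proof. by rewrite /mink !mxE; ring. Qed.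

Lemma minkBl X Y Z : mink (X - Y) Z = mink X Z - mink Y Z.
Proof. by rewrite -scaleN1r minkDl minkZl mulN1r. Qed.

Lemma mink_tangent z u v x Y : mink (tangent z u v x) Y =
  x.1 * mink (z_u z u v) Y + x.2 * mink (z_v z u v) Y.
Proof. by rewrite minkDl !minkZl. Qed.

Lemma normal_part_u z u v X :
  coefE z u v * coefG z u v - coefF z u v ^+ 2 != 0 ->
  mink (normal_part z u v X) (z_u z u v) = 0.
Proof.
rewrite /normal_part minkBl mink_tangent /tangent_coord /=.
rewrite (minkC (z_v _ _ _) (z_u _ _ _)) -/(coefE z u v) -/(coefF z u v).
move: (coefE z u v) (coefF z u v) (coefG z u v) (mink X _) (mink X _).
by move=> E F G p q d0; field.
Qed.

Lemma normal_part_v z u v X :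
  coefE z u v * coefG z u v - coefF z u v ^+ 2 != 0 ->
  mink (normal_part z u v X) (z_v z u v) = 0.
Proof.
rewrite /normal_part minkBl mink_tangent /tangent_coord /=.
rewrite -/(coefF z u v) -/(coefG z u v).
move: (coefE z u v) (coefF z u v) (coefG z u v) (mink X _) (mink X _).
by move=> E F G p q d0; field.
Qed.

Lemma normal_part_tangent z u v x :
  coefE z u v * coefG z u v - coefF z u v ^+ 2 != 0 ->
  normal_part z u v (tangent z u v x) = 0.
Proof.
move=> d0; apply/eqP; rewrite subr_eq0; apply/eqP; congr tangent.
rewrite /tangent_coord !mink_tangent (minkC (z_v _ _ _) (z_u _ _ _)).
rewrite -/(coefE z u v) -/(coefF z u v) -/(coefG z u v).
move: (coefE z u v) (coefF z u v) (coefG z u v) d0 => E F G d0.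
by case: x => p q /=; congr pair; field.
Qed.

End Minkowski.

Arguments e1 {R}.
Arguments e2 {R}.
Arguments e3 {R}.
Arguments e4 {R}.

(* Main.v *)
Require Import Defs.
From HB Require Import structures.
From mathcomp Require Import all_boot all_order all_algebra.
From mathcomp Require Import all_classical all_reals all_analysis.
From mathcomp Require Import ring.

Set Implicit Arguments.
Unset Strict Implicit.
Unset Printing Implicit Defensive.

Import Order.TTheory GRing.Theory Num.Theory.
Import numFieldNormedType.Exports.

Local Open Scope classical_set_scope.
Local Open Scope ring_scope.

(** Write k for the curvature of l, and f', f'', g', g'' for the derivatives of
f and g. The theorem splits into a pointwise computation of the mean curvature
and an ordinary differential equation.

Geometry. As z_u = f' l + g' e1 and z_v = f l', the induced metric is
- du^2 + f^2 dv^2, so (z_v / f, z_u) is an orthonormal tangent frame. The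
quadratic parts of two orthonormal frames of a Lorentzian plane have the same
difference ([lorentz_frame]); hence H = 0 at a point if and only if the vector
W = f^-2 z_vv - z_uu = l'' / f - (f'' l + g'' e1) is tangent there
([mean_curvature_vector_eq0]). The normal plane is spanned by n and
g' l + f' e1. The product of W with n is k / f, and its product with
g' l + f' e1 vanishes exactly when f (f'' g' - f' g'') = g'. Differentiating
f'^2 - g'^2 = 1 gives f' f'' = g' g'', which turns this equation into
f f'' + f'^2 = 1 because g' is nonzero. This is
[second_order_part_tangent]; its converse half also needs that k = 0 forces
l'' = l, that is, that {e1, l, l', n} spans the ambient space.

Differential equation. f f'' + f'^2 = 1 says that (f f')' = 1, so
f f' = u + a and f^2 = u^2 + 2 a u + b. Moreover g' f has zero derivative:
multiplied by g', that derivative becomes f' (f f'' + f'^2 - 1). So g' = C / f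
with C a nonzero constant, C^2 = a^2 - b, and since u + a + f has logarithmic
derivative 1 / f, g is C ln |u + a + f| up to a constant
([meridian_ode_parameters], [meridian_antiderivative]). Having the constant C
at once settles the sign in front of the square root of a^2 - b and the
positivity of a^2 - b. Conversely, differentiating f^2 = u^2 + 2 a u + b twice
gives the equation back.

The intervals may contain their endpoints. Identities known only on the
interval are differentiated there too, which is legitimate since a limit along
points of the interval determines the derivative
([constant_on_derive0]). *)

(** * Calculus on intervals *)

Section Calculus.
Variable R : realType.
Implicit Types (h : R -> R) (I : set R) (x : R).

(** Every point of I, endpoint or not, is a limit of other points of I, where the
difference quotients vanish, whereas they tend to d. *)
Lemma constant_on_derive0 I h (c : R) x (d : R) :
  nondegenerate_interval I -> I x -> (forall y, I y -> h y = c) ->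
  is_derive x 1 h d -> d = 0.
Proof.
move=> [Iitv [p [q [Ip Iq pq]]]] Ix hc [dh hd]; apply/eqP/negPn/negP => d0.
have dgt0 : 0 < `|d| by rewrite normr_gt0.
have : (fun t => t^-1 *: ((h \o shift x) (t *: 1) - h x)) @ 0^' --> d.
  by rewrite -hd; exact: dh.
move/cvgrPdist_lt => /(_ _ dgt0) [e /= e0 near0].
(* One point of I close to x, where the quotient is 0, contradicts |d| > 0. *)
suff [t [t0 te It]] : exists t, [/\ t != 0, `|t| < e & I (t + x)].
  have /(_ _ t0) := near0 t; rewrite /= sub0r normrN => /(_ te).
  by rewrite [t *: 1]mulr1 (hc _ It) (hc _ Ix) subrr scaler0 subr0 ltxx.
have m0 r : 0 < r -> 0 < Num.min (e / 2) r by move=> r0; rewrite lt_min r0 divr_gt0.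
have e2 : e / 2 < e by rewrite gtr_pMr // invf_lt1 ?ltr1n.
(* As p < q, the point x has a point of I on its right or on its left; the step
   is shortened to e / 2 or to stay between x and that point. *)
have [xq|qx] := ltP x q.
  have := m0 (q - x); rewrite subr_gt0 => /(_ xq) t0.
  exists (Num.min (e / 2) (q - x)); split; first by rewrite gt_eqF.
    by rewrite gtr0_norm // gt_min e2.
  apply: (Iitv x q) => //; rewrite lerDr (ltW t0) /=.
  by rewrite -lerBrDr ge_min lexx orbT.
have px : p < x by exact: lt_le_trans qx.
have := m0 (x - p); rewrite subr_gt0 => /(_ px) t0.
exists (- Num.min (e / 2) (x - p)); split; first by rewrite oppr_eq0 gt_eqF.
  by rewrite normrN gtr0_norm // gt_min e2.
apply: (Iitv p x) => //; rewrite gerDr oppr_le0 (ltW t0) andbT.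
by rewrite addrC lerBrDl -lerBrDr ge_min lexx orbT.
Qed.

Lemma derive0_constant_on I h : is_interval I ->
  (forall x, I x -> is_derive x 1 h 0) ->
  forall x y, I x -> I y -> h x = h y.
Proof.
move=> Iitv dh; suff le x y : I x -> I y -> x <= y -> h x = h y.
  move=> x y Ix Iy; have [xy|/ltW yx] := leP x y; first exact: le.
  by apply/esym/le.
move=> Ix Iy xy.
have Ixy t : t \in `[x, y] -> I t by rewrite in_itv /=; exact: Iitv.
have [||c _] := @MVT_segment _ h (fun=> 0) x y xy.
- by move=> t txy; apply/dh/Ixy; exact: subset_itv_oo_cc.
- by apply: derivable_within_continuous => t /Ixy /dh [].
by rewrite mul0r => /subr0_eq.
Qed.

(** ln |y| = ln (y^2) / 2 holds for all y, including y = 0 where ln takes the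
default value 0; the chain rule applied to the right-hand side covers both signs
of h at once. *)
Lemma is_derive_ln_norm h x (d : R) : h x != 0 -> is_derive x 1 h d ->
  is_derive x 1 (fun t => ln `|h t|) (d / h x).
Proof.
move=> hx0 dh.
have sqE t : (h ^+ 2) t = h t ^+ 2 by rewrite !expr2.
have -> : (fun t => ln `|h t|) = 2^-1 *: ((@ln R) \o (h ^+ 2)).
  apply/funext => t; rewrite [RHS]/= -[RHS]/(2^-1 * ln ((h ^+ 2) t)) sqE.
  have [->|ht0] := eqVneq (h t) 0; first by rewrite normr0 expr0n ln0 // mulr0.
  rewrite -[h t ^+ 2]real_normK ?num_real // lnXn ?normr_gt0 //.
  by set L := ln _; rewrite -mulr_natl; field.
have hp : 0 < (h ^+ 2) x by rewrite sqE exprn_even_gt0.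
have dln := is_derive1_ln hp.
by apply: is_derive_eq; rewrite sqE /GRing.scale /= expr1; field.
Qed.

Lemma is_derive_mxP m n (M : R -> 'M[R]_(m, n)) x (d : 'M[R]_(m, n)) :
  is_derive x 1 M d <-> forall i j, is_derive x 1 (fun t => M t i j) (d i j).
Proof.
split=> [[dM <-] i j|dM].
  apply: DeriveDef; first by move/derivable_mxP : dM.
  by rewrite derive_mx // mxE.
have dbl : derivable M x 1 by apply/derivable_mxP => i j; case: (dM i j).
apply: DeriveDef => //; rewrite derive_mx //.
by apply/matrixP => i j; rewrite mxE; case: (dM i j).
Qed.

Lemma is_derive_scalel n h (w : 'rV[R]_n) x (d : R) : is_derive x 1 h d ->
  is_derive x 1 (fun t => h t *: w) (d *: w).
Proof.
move=> dh; apply/is_derive_mxP => i j.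
have -> : (fun t => (h t *: w) i j) = h * cst (w i j).
  by apply/funext => t; rewrite mxE.
by apply: is_derive_eq; rewrite scaler0 add0r mxE mulrC.
Qed.

Lemma is_derive_mink (p q : R -> 'rV[R]_4) x (dp dq : 'rV[R]_4) :
  is_derive x 1 p dp -> is_derive x 1 q dq ->
  is_derive x 1 (fun t => mink (p t) (q t)) (mink dp (q x) + mink (p x) dq).
Proof.
move=> /is_derive_mxP dP /is_derive_mxP dQ.
pose P i t := p t 0 i; pose Q i t := q t 0 i.
have dPi i : is_derive x 1 (P i) (dp 0 i) by exact: dP.
have dQi i : is_derive x 1 (Q i) (dq 0 i) by exact: dQ.
have -> : (fun t => mink (p t) (q t)) =
    P 0 * Q 0 + P 1 * Q 1 + P 2%:R * Q 2%:R - P 3%:R * Q 3%:R by [].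
have dPQ i := is_deriveM (dPi i) (dQi i).
have dmink := is_deriveB (is_deriveD (is_deriveD (dPQ 0) (dPQ 1)) (dPQ 2%:R))
  (dPQ 3%:R).
apply: (@is_derive_eq _ _ _ _ _ _ _ _ dmink); rewrite {dmink dPQ dPi dQi dP dQ}.
rewrite /GRing.scale /= /mink /P /Q.
move: (p x 0 _) (p x 0 _) (p x 0 _) (p x 0 _) => p0 p1 p2 p3.
move: (q x 0 _) (q x 0 _) (q x 0 _) (q x 0 _) => q0 q1 q2 q3.
move: (dp 0 _) (dp 0 _) (dp 0 _) (dp 0 _) => dp0 dp1 dp2 dp3.
move: (dq 0 _) (dq 0 _) (dq 0 _) (dq 0 _) => dq0 dq1 dq2 dq3.
by ring.
Qed.

Lemma mink_constant_on_derive I (p q : R -> 'rV[R]_4) (c : R) x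
    (dp dq : 'rV[R]_4) :
  nondegenerate_interval I -> I x -> (forall t, I t -> mink (p t) (q t) = c) ->
  is_derive x 1 p dp -> is_derive x 1 q dq ->
  mink dp (q x) + mink (p x) dq = 0.
Proof.
move=> Inondeg Ix pq dP dQ.
exact: (constant_on_derive0 Inondeg Ix pq (is_derive_mink dP dQ)).
Qed.

Lemma smooth_on_is_derive (W : normedModType R) (I : set R) (h : R -> W) k x :
  smooth_on I h -> I x -> is_derive x 1 (derive1n k h) (derive1n k.+1 h x).
Proof.
move=> [U [_ IU dh]] Ix; apply: DeriveDef; first exact/dh/IU.
by rewrite -derive1E.
Qed.

End Calculus.

(** * Mean curvature of Lorentzian surfaces *)

Section NormalPart.
Variable R : realType.
Implicit Types (z : R -> R -> 'rV[R]_4) (X Y : 'rV[R]_4) (u v : R).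

Lemma minkDr X Y Z : mink X (Y + Z) = mink X Y + mink X Z :> R.
Proof. by rewrite minkC minkDl !(minkC _ X). Qed.

Lemma minkZr (p : R) X Y : mink X (p *: Y) = p * mink X Y.
Proof. by rewrite minkC minkZl minkC. Qed.

Lemma mink_e1l X : mink e1 X = X 0 0.
Proof. by rewrite /mink !mxE /=; ring. Qed.

Lemma span234_first_coord X : span234 X -> X 0 0 = 0.
Proof. by move=> [p [q [r ->]]]; rewrite !mxE /=; ring. Qed.

Lemma normal_partB z u v X Y :
  normal_part z u v (X - Y) = normal_part z u v X - normal_part z u v Y.
Proof.
rewrite /normal_part /tangent_coord /tangent.
move: (Defs.coefE z u v) (coefF z u v) (coefG z u v) => E F G.
move: (_ - _ ^+ 2)^-1 (z_u z u v) (z_v z u v) => d zu zv /=.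
rewrite !minkBl; move: (mink X zu) (mink X zv) (mink Y zu) (mink Y zv).
move=> pX qX pY qY; apply/rowP => i; rewrite !mxE.
by move: (X 0 i) (Y 0 i) (zu 0 i) (zv 0 i) => Xi Yi zui zvi; ring.
Qed.

Lemma normal_part_eq0 z u v X :
  Defs.coefE z u v * coefG z u v - coefF z u v ^+ 2 != 0 ->
  normal_part z u v X = 0 <-> exists w, X = tangent z u v w.
Proof.
move=> d0; split=> [/subr0_eq XE|[w ->]]; last exact: normal_part_tangent.
by exists (tangent_coord z u v X).
Qed.

Lemma mink_tangent2 z u v (x y : R * R) :
  mink (tangent z u v x) (tangent z u v y) =
  x.1 * y.1 * Defs.coefE z u v + (x.1 * y.2 + x.2 * y.1) * coefF z u v +
  x.2 * y.2 * coefG z u v.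
Proof.
rewrite /tangent /Defs.coefE /coefF /coefG.
move: (z_u z u v) (z_v z u v) => zu zv.
by rewrite minkDl !minkZl !minkDr !minkZr (minkC zv zu); ring.
Qed.

(** The rows of coordinates (x1, F x2) and (y1, F y2) of an orthonormal frame form
a Lorentz matrix. Its transpose is again one, and the relations between columns
are the ones stated; they make x x - y y independent of the frame. *)
Lemma lorentz_frame (F x1 x2 y1 y2 : R) :
  - x1 ^+ 2 + F ^+ 2 * x2 ^+ 2 = 1 -> - y1 ^+ 2 + F ^+ 2 * y2 ^+ 2 = -1 ->
  - (x1 * y1) + F ^+ 2 * (x2 * y2) = 0 ->
  [/\ x1 ^+ 2 - y1 ^+ 2 = -1, F ^+ 2 * (x2 ^+ 2 - y2 ^+ 2) = 1
    & F * (x1 * x2 - y1 * y2) = 0].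
Proof.
move=> hx hy hxy.
have b2 : F ^+ 2 * x2 ^+ 2 = 1 + x1 ^+ 2 by rewrite -hx; ring.
have c2 : y1 ^+ 2 = 1 + F ^+ 2 * y2 ^+ 2 by rewrite -[1]opprK -hy; ring.
have e : x1 * y1 = F ^+ 2 * (x2 * y2) by rewrite -[LHS]addr0 -hxy; ring.
have bc : y1 ^+ 2 = 1 + x1 ^+ 2.
  apply/eqP; rewrite -subr_eq0; apply/eqP.
  have : (x1 * y1) ^+ 2 = (F ^+ 2 * x2 ^+ 2) * (F ^+ 2 * y2 ^+ 2).
    by rewrite e; ring.
  rewrite b2 exprMn [in LHS]c2 => /eqP; rewrite -subr_eq0 => /eqP h.
  by rewrite c2 -[RHS]oppr0 -h; ring.
split; first by rewrite bc; ring.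
  by rewrite mulrBr b2 -bc c2; ring.
(* F x2 is invertible since F^2 x2^2 = 1 + x1^2 > 0. *)
have Fx2 : F * x2 != 0.
  apply/eqP => Fx0; have : 0 < F ^+ 2 * x2 ^+ 2.
    by rewrite b2 ltr_pwDl ?ltr01 // sqr_ge0.
  by rewrite -exprMn Fx0 expr0n ltxx.
apply: (mulfI Fx2); rewrite mulr0.
have -> : F * x2 * (F * (x1 * x2 - y1 * y2)) =
  x1 * (F ^+ 2 * x2 ^+ 2) - y1 * (F ^+ 2 * (x2 * y2)) by ring.
by rewrite -e b2 -bc; ring.
Qed.

Lemma mean_curvature_vectorE z u v (r : R) (x y : R * R) :
  Defs.coefE z u v = -1 -> coefF z u v = 0 -> coefG z u v = r ^+ 2 ->
  r != 0 -> orthonormal_tangent_frame z u v x y ->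
  mean_curvature_vector z u v x y =
  2^-1 *: normal_part z u v (r ^- 2 *: z_vv z u v - z_uu z u v).
Proof.
move=> hE hF hG r0 [].
rewrite !mink_tangent2 hE hF hG.
case: x y => [x1 x2] [y1 y2] /= hx hy hxy.
have [||| h1 h2 h3] := @lorentz_frame r x1 x2 y1 y2.
- by rewrite -[RHS]hx; ring.
- by rewrite -[RHS]hy; ring.
- by rewrite -[RHS]hxy; ring.
rewrite /mean_curvature_vector /sff -normal_partB; congr (_ *: normal_part _ _ _ _).
have h2' : x2 ^+ 2 - y2 ^+ 2 = r ^- 2.
  by apply: (mulfI (expf_neq0 2 r0)); rewrite h2 divff // expf_neq0.
have h3' : x1 * x2 - y1 * y2 = 0.
  by apply: (mulfI r0); rewrite h3 mulr0.
rewrite [LHS]/= -h2'; move: (z_uu z u v) (z_uv z u v) (z_vv z u v) => A B C.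
apply/rowP => i; rewrite !mxE; move: (A 0 i) (B 0 i) (C 0 i) => {}A {}B {}C.
transitivity ((x1 ^+ 2 - y1 ^+ 2) * A + 2 * (x1 * x2 - y1 * y2) * B
  + (x2 ^+ 2 - y2 ^+ 2) * C); first by ring.
by rewrite h1 h3'; ring.
Qed.

(** The frame (z_v / r, z_u) shows that the universally quantified condition is
not vacuous. *)
Lemma mean_curvature_vector_eq0 z u v (r : R) :
  Defs.coefE z u v = -1 -> coefF z u v = 0 -> coefG z u v = r ^+ 2 ->
  r != 0 ->
  (forall x y, orthonormal_tangent_frame z u v x y ->
    mean_curvature_vector z u v x y = 0) <->
  exists w, r ^- 2 *: z_vv z u v - z_uu z u v = tangent z u v w.
Proof.
move=> hE hF hG r0; rewrite -normal_part_eq0; last first.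
  by rewrite hE hF hG expr0n subr0 mulN1r oppr_eq0 expf_neq0.
split=> [H|H x y xy]; last first.
  by rewrite (mean_curvature_vectorE hE hF hG r0 xy) H scaler0.
have frame : orthonormal_tangent_frame z u v (0, r^-1) (1, 0).
  by split; rewrite mink_tangent2 hE hF hG /=; field.
have /eqP := H _ _ frame; rewrite (mean_curvature_vectorE hE hF hG r0 frame).
by rewrite scaler_eq0 invr_eq0 pnatr_eq0 /= => /eqP.
Qed.

End NormalPart.

(** * Tangency of the second order part *)

Section OrthonormalFrames.
Variable R : realType.
Implicit Types (X L T N A : 'rV[R]_4).

Lemma mink_sum X Y :
  mink X Y = \sum_i X 0 i * ((-1) ^+ (i == 3%:R :> 'I_4) * Y 0 i) :> R.
Proof.
rewrite !big_ord_recl big_ord0 /mink.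
rewrite [lift _ (lift _ (lift _ _))](_ : _ = 3%:R); last exact: val_inj.
rewrite [lift _ (lift _ _)](_ : _ = 2%:R); last exact: val_inj.
rewrite [lift _ _](_ : _ = 1); last exact: val_inj.
rewrite (_ : ord0 = 0 :> 'I_4); last exact: val_inj.
by rewrite /= expr0 expr1; ring.
Qed.

(** The matrix M with rows e1, L, T, N has a right inverse B by orthonormality: its
columns are the same vectors, with the signs of the metric and of the norms.
A right inverse of a square matrix is a left inverse, and the entries of X B are
the products of X with e1, L, T and N up to sign. *)
Lemma orthonormal_frame_nondegenerate L T N X :
  L 0 0 = 0 -> T 0 0 = 0 -> N 0 0 = 0 ->
  mink L L = -1 -> mink T T = 1 -> mink N N = 1 ->
  mink T L = 0 -> mink N L = 0 -> mink N T = 0 ->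
  X 0 0 = 0 -> mink X L = 0 -> mink X T = 0 -> mink X N = 0 -> X = 0.
Proof.
move=> L0 T0 N0 LL TT NN TL NL NT X0 XL XT XN.
pose s : seq 'rV[R]_4 := [:: e1; L; T; N].
pose M : 'M[R]_4 := \matrix_(i, j) s`_i 0 j.
pose B : 'M[R]_4 := \matrix_(i, j)
  ((-1) ^+ (i == 3%:R :> 'I_4) * s`_j 0 i * (-1) ^+ (j == 1 :> 'I_4)).
have XB (Y : 'rV[R]_4) (Z : 'I_4) : \sum_i Y 0 i * B i Z =
    mink Y s`_Z * (-1) ^+ (Z == 1 :> 'I_4).
  by rewrite mink_sum mulr_suml; apply: eq_bigr => i _; rewrite mxE !mulrA.
have e11 : mink (R := R) e1 e1 = 1 by rewrite mink_e1l mxE.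
have MB : M *m B = 1%:M.
  apply/matrixP => i j; rewrite [LHS]mxE [RHS]mxE.
  under eq_bigr do rewrite [M _ _]mxE.
  rewrite XB; case: i j => [[|[|[|[|//]]]] i4] [[|[|[|[|//]]]] j4];
  rewrite /= ?(minkC _ e1, mink_e1l, L0, T0, N0) ?(mxE _ _ 0 0) /=
    ?(LL, TT, NN, TL, NL, NT, minkC L T, minkC L N, minkC T N) /=
    ?(expr0, expr1, mul0r, mulr1, mulN1r, opprK) //=.
have XB0 : X *m B = 0.
  apply/rowP => j; rewrite [LHS]mxE [RHS]mxE XB.
  case: j => [[|[|[|[|//]]]] j4] /=;
    by rewrite ?(XL, XT, XN, mul0r) // minkC mink_e1l X0 mul0r.
by rewrite -[X]mulmx1 -(mulmx1C MB) mulmxA XB0 mul0mx.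
Qed.

Lemma meridian_gram L T (r f1 g1 : R) :
  L 0 0 = 0 -> T 0 0 = 0 -> mink L L = -1 -> mink T T = 1 -> mink T L = 0 ->
  [/\ mink (f1 *: L + g1 *: e1) (f1 *: L + g1 *: e1) = g1 ^+ 2 - f1 ^+ 2,
      mink (f1 *: L + g1 *: e1) (r *: T) = 0
    & mink (r *: T) (r *: T) = r ^+ 2].
Proof.
move=> L0 T0 LL TT TL; rewrite !(minkDl, minkZl, minkDr, minkZr).
rewrite (minkC L e1) (minkC L T) !mink_e1l L0 T0 LL TT TL mxE /=.
by split; ring.
Qed.

(** This is the algebra at one point of the surface: L, T, N, A stand for l, l', n,
l'' and r, f1, f2, g1, g2 for f, f', f'', g', g''. Tangency is tested against N
and g1 L + f1 e1, which are orthogonal to both tangent vectors. *)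
Lemma second_order_part_tangent L T N A (r f1 g1 f2 g2 : R) :
  L 0 0 = 0 -> T 0 0 = 0 -> N 0 0 = 0 -> A 0 0 = 0 ->
  mink L L = -1 -> mink T T = 1 -> mink N N = 1 ->
  mink T L = 0 -> mink N L = 0 -> mink N T = 0 ->
  mink A L = -1 -> mink A T = 0 ->
  r != 0 -> g1 != 0 -> f1 ^+ 2 - g1 ^+ 2 = 1 -> f1 * f2 = g1 * g2 ->
  (exists w : R * R, r ^- 2 *: (r *: A) - (f2 *: L + g2 *: e1) =
     w.1 *: (f1 *: L + g1 *: e1) + w.2 *: (r *: T)) <->
  mink A N = 0 /\ r * f2 + f1 ^+ 2 = 1.
Proof.
move=> L0 T0 N0 A0 LL TT NN TL NL NT AL AT r0 g10 fg1 fg2; split.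
  move=> [[w1 w2] /= E]; split.
    have := congr1 (fun X => mink X N) E; rewrite !(minkBl, minkDl, minkZl).
    rewrite mink_e1l N0 (minkC L N) (minkC T N) NL NT !(mulr0, addr0) subr0.
    move=> /eqP; rewrite !mulf_eq0 invr_eq0 expf_eq0 (negbTE r0) /=.
    by move/eqP.
  have := congr1 (fun X => mink X (g1 *: L + f1 *: e1)) E.
  rewrite !(minkBl, minkDl, minkZl, minkDr, minkZr) LL AL TL !mink_e1l.
  rewrite !(minkC _ e1) !mink_e1l L0 T0 A0 mxE /= => {}E.
  have {}E : f2 * g1 - g2 * f1 = r^-1 * g1.
    transitivity (r ^- 2 * (r * (g1 * -1 + f1 * 0)) -
      (f2 * (g1 * -1 + f1 * 0) + g2 * (g1 * 0 + f1 * 1)) + r^-1 * g1).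
      by field.
    by rewrite E; field.
  (* Multiplying E by g1 and using f1 f2 = g1 g2 leaves only f2. *)
  have : (f2 * g1 - g2 * f1) * g1 = r^-1 * g1 * g1 by rewrite E.
  have -> : (f2 * g1 - g2 * f1) * g1 = - f2 * (f1 ^+ 2 - g1 ^+ 2).
    transitivity (f2 * g1 ^+ 2 - f1 * (g1 * g2)); first by ring.
    by rewrite -fg2; ring.
  rewrite fg1 mulr1 => f2E.
  have -> : f2 = - (r^-1 * g1 * g1) by rewrite -f2E opprK.
  have -> : f1 ^+ 2 = 1 + g1 ^+ 2 by rewrite -fg1 subrK.
  by field.
(* A - L is orthogonal to the whole frame e1, L, T, N. *)
move=> [AN ode]; have -> : A = L.
  apply: subr0_eq; apply: (@orthonormal_frame_nondegenerate L T N) => //.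
  - by rewrite !mxE A0 L0 subr0.
  - by rewrite minkBl AL LL subrr.
  - by rewrite minkBl AT minkC TL subr0.
  - by rewrite minkBl AN minkC NL subr0.
have f2E : f2 = - (r^-1 * g1 ^+ 2).
  apply: (mulfI r0); transitivity (r * f2 + f1 ^+ 2 - f1 ^+ 2); first by ring.
  by rewrite ode -fg1; field.
(* The e1 components force the coefficient of the first tangent vector. *)
exists (- (g2 / g1), 0) => /=; rewrite scale0r addr0.
have g2E : g2 = f1 * f2 / g1 by rewrite fg2; field.
have f1E : f1 ^+ 2 = 1 + g1 ^+ 2 by rewrite -fg1 subrK.
apply/rowP => i; rewrite !mxE; move: (L 0 i) (_%:R) => Li d.
transitivity ((r^-1 - f2) * Li - g2 * d); first by field.
have -> : r^-1 - f2 = - (g2 / g1 * f1).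
  rewrite g2E; transitivity (r^-1 * f1 ^+ 2); first by rewrite f2E f1E; field.
  by rewrite f2E; field; apply/andP.
by field.
Qed.

End OrthonormalFrames.

(** * The differential equation of the meridian *)

Section MeridianCurve.
(** The successive derivatives are separate functions rather than terms in f and
g: only their values on I are constrained. *)
Variables (R : realType) (I : set R) (f f1 f2 g g1 g2 : R -> R).
Hypothesis Inondeg : nondegenerate_interval I.
Hypothesis df : forall u, I u -> is_derive u 1 f (f1 u).
Hypothesis df1 : forall u, I u -> is_derive u 1 f1 (f2 u).
Hypothesis dg : forall u, I u -> is_derive u 1 g (g1 u).
Hypothesis dg1 : forall u, I u -> is_derive u 1 g1 (g2 u).
Hypothesis fpos : forall u, I u -> 0 < f u.
Hypothesis fg1 : forall u, I u -> f1 u ^+ 2 - g1 u ^+ 2 = 1.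
Hypothesis g10 : forall u, I u -> g1 u != 0.

Let scaleE (a b : R) : a *: (b : R^o) = a * b. Proof. by []. Qed.

Lemma meridian_derive2 u : I u -> f1 u * f2 u = g1 u * g2 u.
Proof.
move=> Iu; 
have d := is_deriveB (is_deriveM (df1 Iu) (df1 Iu))
  (is_deriveM (dg1 Iu) (dg1 Iu)).
have := constant_on_derive0 Inondeg Iu (c := 1) _ d; rewrite !scaleE => d0.
have {d0}d0 := d0 _; apply/subr0_eq/(@mulfI _ 2); first by rewrite pnatr_eq0.
rewrite mulr0 -[RHS]d0; first by ring.
by move=> t It; rewrite -(fg1 It) !expr2.
Qed.

(** The three first integrals of the equation are f f' - u, f^2 - (u + a)^2 and
g' f. *)
Lemma meridian_ode_parameters :
  (forall u, I u -> f u * f2 u + f1 u ^+ 2 = 1) ->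
  exists a b C : R, [/\ C != 0, C ^+ 2 = a ^+ 2 - b & forall u, I u ->
    [/\ f u * f1 u = u + a, f u ^+ 2 = u ^+ 2 + 2 * a * u + b
      & g1 u * f u = C]].
Proof.
move=> ode; have [Iitv [u0 [_ [Iu0 _ _]]]] := Inondeg.
have cst1 u : I u -> (f * f1 - id) u = (f * f1 - id) u0.
  move=> Iu; apply: (derive0_constant_on Iitv) => // t It.
  have d := is_deriveB (is_deriveM (df It) (df1 It)) (is_derive_id t 1).
  apply: (@is_derive_eq _ _ _ _ _ _ _ _ d).
  by rewrite !scaleE -(ode t It); ring.
move: ((f * f1 - id) u0) cst1 => a cst1.
have ff1 u : I u -> f u * f1 u = u + a.
  by move=> /cst1 <-; rewrite -[(_ - _) u]/(f u * f1 u - u); ring.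
have cst2 u : I u -> (f * f - (id + cst a) * (id + cst a)) u =
    (f * f - (id + cst a) * (id + cst a)) u0.
  move=> Iu; apply: (derive0_constant_on Iitv) => // t It.
  have d' := is_deriveD (is_derive_id t 1) (is_derive_cst a t 1).
  have d := is_deriveB (is_deriveM (df It) (df It)) (is_deriveM d' d').
  apply: (@is_derive_eq _ _ _ _ _ _ _ _ d); rewrite !scaleE ff1 //=.
  by rewrite -[(id + cst a) t]/(t + a); ring.
move: (_ u0) cst2 => c cst2.
have f2E u : I u -> f u ^+ 2 = (u + a) ^+ 2 + c.
  move=> /cst2 <-.
  by rewrite -[(_ - _) u]/(f u * f u - (u + a) * (u + a)); ring.
have cst3 u : I u -> (g1 * f) u = (g1 * f) u0.
  move=> Iu; apply: (derive0_constant_on Iitv) => // t It.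
  have d := is_deriveM (dg1 It) (df It).
  apply: (@is_derive_eq _ _ _ _ _ _ _ _ d); rewrite !scaleE.
  apply: (mulfI (g10 It)); rewrite mulr0.
  transitivity (f1 t * g1 t ^+ 2 + f t * (g1 t * g2 t)); first by ring.
  rewrite -meridian_derive2 //.
  transitivity (f1 t * (f t * f2 t + f1 t ^+ 2 - (f1 t ^+ 2 - g1 t ^+ 2))).
    by ring.
  by rewrite ode // fg1 // subrr mulr0.
exists a, (a ^+ 2 + c), ((g1 * f) u0); split.
- by rewrite mulf_neq0 ?g10 // gt_eqF // fpos.
- rewrite -[(g1 * f) u0]/(g1 u0 * f u0) exprMn.
  have -> : g1 u0 ^+ 2 = f1 u0 ^+ 2 - 1 by rewrite -(fg1 Iu0); ring.
  rewrite mulrBl mul1r -exprMn [f1 u0 * _]mulrC ff1 // f2E //; ring.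
- move=> u Iu; split; first exact: ff1.
    by rewrite f2E //; ring.
  exact: cst3.
Qed.

(** The logarithm is differentiable because (u + a)^2 - f^2 = C^2 is nonzero, so
that u + a + f has no zero on I. *)
Lemma meridian_antiderivative (a b C : R) : C != 0 -> C ^+ 2 = a ^+ 2 - b ->
  (forall u, I u ->
    [/\ f u * f1 u = u + a, f u ^+ 2 = u ^+ 2 + 2 * a * u + b
      & g1 u * f u = C]) ->
  exists c, forall u, I u -> g u = C * ln `|u + a + f u| + c.
Proof.
move=> C0 C2 H; 
have [Iitv [u0 [_ [Iu0 _ _]]]] := Inondeg.
pose h := id + cst a + f; pose k := g - C *: (fun u => ln `|h u|).
have h0 u : I u -> h u != 0.
  move=> Iu; apply: contra_neq C0 => hu0; apply/eqP; rewrite -sqrf_eq0 C2.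
  have [_ f2E _] := H u Iu; apply/eqP.
  transitivity ((u + a + f u) * (u + a - f u)).
    transitivity ((u + a) ^+ 2 - f u ^+ 2); last by ring.
    by rewrite f2E; ring.
  by rewrite -[_ + f u]/(h u) hu0 mul0r.
have kcst u : I u -> k u = k u0.
  move=> Iu; apply: (derive0_constant_on Iitv) => // t It.
  have dh := is_deriveD (is_deriveD (is_derive_id t 1) (is_derive_cst a t 1))
    (df It).
  have d := is_deriveB (dg It) (is_deriveZ C (is_derive_ln_norm (h0 t It) dh)).
  apply: (@is_derive_eq _ _ _ _ _ _ _ _ d); rewrite !scaleE.
  have [ff1 _ <-] := H t It; have f0 : f t != 0 by rewrite gt_eqF ?fpos.
  have ht0 := h0 t It; apply: (mulfI ht0); rewrite mulr0 mulrBr.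
  have hE : h t = f t * f1 t + f t by rewrite ff1.
  transitivity (g1 t * h t - g1 t * f t * (1 + f1 t)); first by field.
  by rewrite hE; ring.
exists (k u0) => u Iu; rewrite -(kcst u Iu) /k.
rewrite -[(_ - _) u]/(g u - C * ln `|u + a + f u|); ring.
Qed.

Lemma meridian_ode_of_explicit (a b : R) :
  (forall u, I u -> f u ^+ 2 = u ^+ 2 + 2 * a * u + b) ->
  forall u, I u -> f u * f2 u + f1 u ^+ 2 = 1.
Proof.
move=> f2E.
have ff1 u : I u -> f u * f1 u = u + a.
  move=> Iu; pose q : R -> R := id + cst a.
  have dq : is_derive u 1 q 1.
    by apply: is_derive_eq; rewrite addr0.
  have d := is_deriveB (is_deriveM (df Iu) (df Iu)) (is_deriveM dq dq).
  have := constant_on_derive0 Inondeg Iu (c := b - a ^+ 2) _ d.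
  rewrite !scaleE -[q u]/(u + a) => d0.
  apply/subr0_eq/(@mulfI _ 2); first by rewrite pnatr_eq0.
  rewrite mulr0 -[RHS]d0; first by ring.
  move=> t It; rewrite -[(_ - _) t]/(f t * f t - (t + a) * (t + a)).
  by rewrite -expr2 f2E //; ring.
move=> u Iu.
have d := is_deriveB (is_deriveM (df Iu) (df1 Iu)) (is_derive_id u 1).
have := constant_on_derive0 Inondeg Iu (c := a) _ d; rewrite !scaleE => d0.
apply/subr0_eq; rewrite -[RHS]d0; first by ring.
by move=> t It; rewrite -[(_ - _) t]/(f t * f1 t - t) ff1 //; ring.
Qed.

(** Positivity of f excludes the negative square root, and the sign of C is the
one in front of the logarithm. *)
Lemma meridian_odeP :
  (forall u, I u -> f u * f2 u + f1 u ^+ 2 = 1) <->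
  exists a b c : R, 0 < a ^+ 2 - b /\
    exists s1 s2 : bool, forall u, I u ->
      f u = (-1) ^+ s1 * Num.sqrt (u ^+ 2 + 2 * a * u + b) /\
      g u = (-1) ^+ s2 * Num.sqrt (a ^+ 2 - b)
              * ln `|u + a + Num.sqrt (u ^+ 2 + 2 * a * u + b)| + c.
Proof.
split=> [/meridian_ode_parameters|].
  move=> [a [b [C [C0 C2 H]]]].
  have [c gE] := meridian_antiderivative C0 C2 H.
  exists a, b, c; split; first by rewrite -C2 lt_def sqr_ge0 sqrf_eq0 C0.
  exists false, (C < 0) => u Iu; have [_ <- _] := H u Iu.
  rewrite -C2 !sqrtr_sqr gtr0_norm ?fpos // expr0 mul1r; split => //.
  by rewrite -numEsign gE.
move=> [a [b [c [_ [s1 [s2 H]]]]]]; apply: (@meridian_ode_of_explicit a b).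
move=> u Iu; have [fE _] := H u Iu; have := fpos Iu.
rewrite fE exprMn sqrr_sign mul1r; set p := _ + b => sp.
have [/ltW p0|p0] := ltP 0 p; first by rewrite sqr_sqrtr.
by move: sp; rewrite ler0_sqrtr // mulr0 ltxx.
Qed.

End MeridianCurve.

(** * Meridian surfaces *)

Section MeridianSurface.
Variables (R : realType) (I J : set R) (f g : R -> R) (l n : R -> 'rV[R]_4).
Hypothesis hM : timelike_meridian_surface_II_hyperbolic I J f g l.
Hypothesis hn : normal_field J l n.

Local Notation f1 := (derive1 f).
Local Notation f2 := (derive1n 2 f).
Local Notation g1 := (derive1 g).
Local Notation g2 := (derive1n 2 g).
Local Notation t := (derive1 l).
Local Notation t1 := (derive1n 2 l).
Local Notation z := (meridian_surface f g l).

Let ls : smooth_on J l. Proof. by case: hM => _ _ _ []. Qed.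
Let dl v : J v -> is_derive v 1 l (t v). Proof. exact: (smooth_on_is_derive 0 ls). Qed.
Let dt v : J v -> is_derive v 1 t (t1 v). Proof. exact: (smooth_on_is_derive 1 ls). Qed.

Lemma curve_first_coord v : J v -> [/\ l v 0 0 = 0, t v 0 0 = 0 & t1 v 0 0 = 0].
Proof.
have [_ Jnondeg _ [_ lH2 _]] := hM.
have l0 s : J s -> l s 0 0 = 0 by move=> /lH2 [/span234_first_coord].
have t0 s : J s -> t s 0 0 = 0.
  move=> Js; have /is_derive_mxP /(_ 0 0) d := dl Js.
  exact: (constant_on_derive0 Jnondeg Js l0 d).
move=> Jv; split; [exact: l0|exact: t0|].
have /is_derive_mxP /(_ 0 0) d := dt Jv.
exact: (constant_on_derive0 Jnondeg Jv t0 d).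
Qed.

(** Each relation is the derivative of an earlier one: <l, l> = -1, <l', l'> = 1
and <l', l> = 0. *)
Lemma curve_frenet v : J v ->
  [/\ mink (t v) (l v) = 0, mink (t1 v) (t v) = 0 & mink (t1 v) (l v) = -1].
Proof.
have [_ Jnondeg _ [_ lH2 tt]] := hM.
have tl s : J s -> mink (t s) (l s) = 0.
  move=> Js; have ll r : J r -> mink (l r) (l r) = -1 by move=> /lH2 [].
  have := mink_constant_on_derive Jnondeg Js ll (dl Js) (dl Js).
  rewrite (minkC (l s)) -mulr2n -mulr_natl => /eqP.
  by rewrite mulf_eq0 pnatr_eq0 /= => /eqP.
move=> Jv; split; first exact: tl.
  have := mink_constant_on_derive Jnondeg Jv tt (dt Jv) (dt Jv).
  rewrite (minkC (t v)) -mulr2n -mulr_natl => /eqP.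
  by rewrite mulf_eq0 pnatr_eq0 /= => /eqP.
have := mink_constant_on_derive Jnondeg Jv tl (dt Jv) (dl Jv).
by rewrite tt // => /eqP; rewrite addr_eq0 => /eqP.
Qed.

Lemma meridian_z_u u v : I u -> z_u z u v = f1 u *: l v + g1 u *: e1.
Proof.
move=> Iu; have [_ _ [fs gs _ _ _] _] := hM.
have d := is_deriveD (is_derive_scalel (l v) (smooth_on_is_derive 0 fs Iu))
  (is_derive_scalel e1 (smooth_on_is_derive 0 gs Iu)).
by rewrite /z_u derive1E; case: d.
Qed.

Lemma meridian_z_v u v : J v -> z_v z u v = f u *: t v.
Proof.
move=> Jv; have d := is_deriveD (is_deriveZ (f u) (dl Jv))
  (is_derive_cst (g u *: e1) v 1).
by rewrite addr0 in d; rewrite /z_v derive1E; case: d.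
Qed.

(** The formula for z_u holds on a whole neighbourhood of u, beyond I if u is an
endpoint, and can therefore be differentiated. *)
Lemma meridian_z_uu u v : I u -> z_uu z u v = f2 u *: l v + g2 u *: e1.
Proof.
move=> Iu; have [_ _ [fs gs _ _ _] _] := hM.
have d := is_deriveD (is_derive_scalel (l v) (smooth_on_is_derive 1 fs Iu))
  (is_derive_scalel e1 (smooth_on_is_derive 1 gs Iu)).
rewrite -[RHS](@derive_val _ _ _ _ _ _ _ d) /z_uu derive1E.
have [Uf [Ufo IUf df]] := fs; have [Ug [Ugo IUg dg]] := gs.
apply: near_eq_derive; near=> s.
have Us : Uf s by near: s; apply: open_nbhs_nbhs; split=> //; exact: IUf.
have Vs : Ug s by near: s; apply: open_nbhs_nbhs; split=> //; exact: IUg.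
have ds := is_deriveD (is_derive_scalel (l v) (derivableP (df 0 s Us)))
  (is_derive_scalel e1 (derivableP (dg 0 s Vs))).
by rewrite /z_u derive1E (@derive_val _ _ _ _ _ _ _ ds) -!derive1E.
Unshelve. all: by end_near. Qed.

Lemma meridian_z_vv u v : J v -> z_vv z u v = f u *: t1 v.
Proof.
move=> Jv; have d := is_deriveZ (f u) (dt Jv).
rewrite -[RHS](@derive_val _ _ _ _ _ _ _ d) /z_vv derive1E.
have [U [Uo JU dU]] := ls.
apply: near_eq_derive; near=> s.
have Us : U s by near: s; apply: open_nbhs_nbhs; split=> //; exact: JU.
have ds := is_deriveD (is_deriveZ (f u) (derivableP (dU 0 s Us)))
  (is_derive_cst (g u *: e1) s 1).
by rewrite /z_v derive1E (@derive_val _ _ _ _ _ _ _ ds) addr0 -!derive1E.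
Unshelve. all: by end_near. Qed.

Lemma meridian_mean_curvature_eq0 u v : I u -> J v ->
  (forall x y, orthonormal_tangent_frame z u v x y ->
    mean_curvature_vector z u v x y = 0) <->
  curvature l n v = 0 /\ f u * f2 u + f1 u ^+ 2 = 1.
Proof.
move=> Iu Jv; have [Inondeg _ [fs gs fpos fg1 g10] [_ lH2 tt]] := hM.
have [_ /(_ v Jv) [/span234_first_coord n0 nn nl nt]] := hn.
have [l0 t0 t10] := curve_first_coord Jv.
have [tl t1t t1l] := curve_frenet Jv.
have ll : mink (l v) (l v) = -1 by case: (lH2 v Jv).
have f0 : f u != 0 by rewrite gt_eqF ?fpos.
have fg2 : f1 u * f2 u = g1 u * g2 u.
  exact: (meridian_derive2 Inondeg (fun u => smooth_on_is_derive 1 fs)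
    (fun u => smooth_on_is_derive 1 gs) fg1 Iu).
have [hE hF hG] := meridian_gram (f u) (f1 u) (g1 u) l0 t0 ll (tt v Jv) tl.
rewrite -(meridian_z_u v Iu) in hE hF; rewrite -(meridian_z_v u Jv) in hF hG.
have {}hE : mink (z_u z u v) (z_u z u v) = -1 by rewrite hE -opprB fg1.
apply: (iff_trans (mean_curvature_vector_eq0 hE hF hG f0)).
rewrite (meridian_z_uu v Iu) (meridian_z_vv u Jv).
rewrite /tangent (meridian_z_u v Iu) (meridian_z_v u Jv).
exact: (second_order_part_tangent l0 t0 n0 t10 ll (tt v Jv) nn tl nl nt t1l t1t
  f0 (g10 u Iu) (fg1 u Iu) fg2).
Qed.

Lemma minimal_meridian_surfaceP :
  minimal z I J <-> (forall v, J v -> curvature l n v = 0) /\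
    (forall u, I u -> f u * f2 u + f1 u ^+ 2 = 1).
Proof.
have [[_ [u0 [_ [Iu0 _ _]]]] [_ [v0 [_ [Jv0 _ _]]]] _ _] := hM.
split=> [min|[k0 ode] u v Iu Jv]; last first.
  by apply/meridian_mean_curvature_eq0 => //; split; [exact: k0|exact: ode].
have H u v Iu Jv := (meridian_mean_curvature_eq0 Iu Jv).1 (min u v Iu Jv).
by split=> [v /(H u0 v Iu0) []|u /H /(_ Jv0) []].
Qed.

End MeridianSurface.

Theorem theorem6p2 (R : realType) (I J : set R) (f g : R -> R)
    (l n : R -> 'rV[R]_4)
    (hM : timelike_meridian_surface_II_hyperbolic I J f g l)
    (hn : normal_field J l n) :
  minimal (meridian_surface f g l) I J <->
  (forall v, J v -> curvature l n v = 0) /\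
  (exists a b c : R, 0 < a ^+ 2 - b /\
    exists s1 s2 : bool, forall u, I u ->
      f u = (-1) ^+ s1 * Num.sqrt (u ^+ 2 + 2 * a * u + b) /\
      g u = (-1) ^+ s2 * Num.sqrt (a ^+ 2 - b)
              * ln `|u + a + Num.sqrt (u ^+ 2 + 2 * a * u + b)| + c).
Proof.
have [Inondeg _ [fs gs fpos fg1 g10] _] := hM.
rewrite (minimal_meridian_surfaceP hM hn).
by rewrite (meridian_odeP Inondeg (fun u => smooth_on_is_derive 0 fs)
  (fun u => smooth_on_is_derive 1 fs) (fun u => smooth_on_is_derive 0 gs)
  (fun u => smooth_on_is_derive 1 gs) fpos fg1 g10).
Qed.
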